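(* Let $K\in L_0(\Omega\times\Omega')$ be a generalized Mercer kernel, $K(x,y)=\sum_{n\in\mathbb{N}}\phi_n(x)\phi_n'(y)$ (pointwise convergent), whose expansion sets $\{\phi_n\}_{n\in\mathbb{N}}\subseteq L_0(\Omega)$ and $\{\phi_n'\}_{n\in\mathbb{N}}\subseteq L_0(\Omega')$ are linearly independent and satisfy $\sum_n|\phi_n(x)|<\infty$ for all $x\in\Omega$ and $\sum_n|\phi_n'(y)|<\infty$ for all $y\in\Omega'$, and such that the right-sided kernel set $\{K(x,\cdot):x\in\Omega\}$ is linearly independent. Let $x_1,\dots,x_N\in\Omega$ be any pairwise distinct points and $y_1,\dots,y_N\in\mathbb{R}$ any values. Let $R:[0,\infty)\to[0,\infty)$ be convex and strictly increasing, and let $L:\Omega\times\mathbb{R}\times\mathbb{R}\to[0,\infty)$ be such that $t\mapsto L(x,y,t)$ is convex for each fixed $x\in\Omega$, $y\in\mathbb{R}$. For $1\le p\le2$ define $$\mathcal{T}_p(f):=\frac1N\sum_{k=1}^NL(x_k,y_k,f(x_k))+R\big(\|f\|_{\mathcal{B}_K^p(\Omega)}\big),\qquad f\in\mathcal{B}_K^p(\Omega),$$ and for $1<p\le2$ let $s_p$ be the unique minimizer of $\mathcal{T}_p$ over $\mathcal{B}_K^p(\Omega)$. Then the support vector machine $\min_{f\in\mathcal{B}_K^1(\Omega)}\mathcal{T}_1(f)$ has a global minimum solution $s_1\in\mathcal{B}_K^1(\Omega)$, and there exists a sequence $(p_m)_{m\in\mathbb{N}}\subseteq(1,2]$ with $\lim_{m\to\infty}p_m=1$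 such that $$\lim_{m\to\infty}s_{p_m}(x)=s_1(x)\ \text{ for all }x\in\Omega,\qquad\text{and}\qquad\lim_{m\to\infty}\mathcal{T}_{p_m}(s_{p_m})=\mathcal{T}_1(s_1).$$
   Context: $\Omega,\Omega'$ are locally compact Hausdorff spaces equipped with regular Borel measures. $L_0(X)$ denotes the set of real-valued measurable functions on $X$ (genuine functions). For $1\le p<\infty$ the space $\mathcal{B}_K^p(\Omega)$ is $\{f=\sum_{n}a_n\phi_n:(a_n)\in\ell_p\}$ with norm $\|f\|_{\mathcal{B}_K^p(\Omega)}=(\sum_n|a_n|^p)^{1/p}$ (series converge pointwise; the norm is taken to be well defined in terms of the coefficients). A countable family of functions is linearly independent if no nontrivial finite linear combination of distinct members vanishes; linear independence of $\{K(x,\cdot):x\in\Omega\}$ means that for any pairwise distinct $z_1,\dots,z_M\in\Omega$, $\sum_kc_kK(z_k,\cdot)=0$ implies all $c_k=0$. In the paper, existence and uniqueness of the minimizer $s_p$ for $1<p\le2$ under the stated hypotheses is a previously established result. *)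

(* Defs.v *)
From HB Require Import structures.
From mathcomp Require Import all_boot all_order all_algebra.
From mathcomp Require Import all_classical all_reals all_analysis.

Set Implicit Arguments.
Unset Strict Implicit.
Unset Printing Implicit Defensive.

Import Order.TTheory GRing.Theory Num.Theory.
Import numFieldNormedType.Exports.

Local Open Scope classical_set_scope.
Local Open Scope ring_scope.

HB.instance Definition _ (X Y : ptopologicalType) := Pointed.on (X * Y)%type.

Notation borel X := (g_sigma_algebraType (@open X)).

(* The conventions for regularity in the literature differ on the sets for
   which inner regularity is required and on finiteness on compact sets; this
   is what they have in common. *)
Definition regular_borel (R : realType) (X : ptopologicalType)
    (mu : {measure set (borel X) -> \bar R}) : Prop :=
  (forall A : set (borel X), measurable A ->
     mu A = ereal_inf [set mu U | U in [set U : set X | open U /\ A `<=` U]]) /\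
  (forall U : set X, open U ->
     mu U = ereal_sup [set mu C | C in [set C : set X | compact C /\ C `<=` U]]).

Definition L0 (R : realType) (X : ptopologicalType) : set (X -> R) :=
  [set f | measurable_fun [set: borel X] (f : borel X -> R)].

(* Indexing by injective tuples expresses "finitely many distinct members". *)
Definition lin_indep (R : realType) (I X : Type) (F : I -> X -> R) : Prop :=
  forall (M : nat) (z : 'I_M -> I) (c : 'I_M -> R), injective z ->
    (forall x, \sum_(k < M) c k * F (z k) x = 0) -> forall k, c k = 0.

Section GeneralizedMercer.
Variable R : realType.

Record generalized_mercer (X Y : ptopologicalType) (K : X * Y -> R)
    (phi : nat -> X -> R) (phi' : nat -> Y -> R) : Prop := GeneralizedMercer {
  mercer_L0 : L0 K ;
  mercer_L0_left : forall n, L0 (phi n) ;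
  mercer_L0_right : forall n, L0 (phi' n) ;
  mercer_indep_left : lin_indep phi ;
  mercer_indep_right : lin_indep phi' ;
  mercer_expansion : forall x y,
    series (fun n => phi n x * phi' n y) @ \oo --> K (x, y)
}.

Definition lpnorm (p : R) (a : nat -> R) : \bar R :=
  'N[counting]_(p%:E)[EFin \o a]%E.

Definition lp (p : R) : set (nat -> R) := [set a | (lpnorm p a < +oo)%E].

Section BK.
Variables (X : ptopologicalType) (phi : nat -> X -> R).

Definition expands (a : nat -> R) (f : X -> R) : Prop :=
  forall x, series (fun n => a n * phi n x) @ \oo --> f x.

Definition BK (p : R) : set (X -> R) :=
  [set f | exists2 a, lp p a & expands a f].

(* Linear independence of phi alone does not prevent two sequences in l_p from
   expanding the same function. *)
Definition BKnorm_well_defined (p : R) : Prop :=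
  forall f a b, lp p a -> lp p b -> expands a f -> expands b f ->
    lpnorm p a = lpnorm p b.

Definition BKcoef (p : R) (f : X -> R) : nat -> R :=
  xget (fun=> 0) [set a | lp p a /\ expands a f].

Definition BKnorm (p : R) (f : X -> R) : R := fine (lpnorm p (BKcoef p f)).

Definition svm (L : X -> R -> R -> R) (rho : R -> R) (N : nat)
    (x : 'I_N -> X) (y : 'I_N -> R) (p : R) (f : X -> R) : R :=
  N%:R^-1 * \sum_(k < N) L (x k) (y k) (f (x k)) + rho (BKnorm p f).

End BK.

Definition is_minimizer (T : Type) (A : set T) (J : T -> R) (f : T) : Prop :=
  A f /\ forall g, A g -> J f <= J g.

End GeneralizedMercer.

Lemma BKnormE (R : realType) (X : ptopologicalType) (phi : nat -> X -> R)
    (p : R) (a : nat -> R) (f : X -> R) :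
  BKnorm_well_defined phi p -> lp p a -> expands phi a f ->
  BKnorm phi p f = fine (lpnorm p a).
Proof.
move=> wd pa af; rewrite /BKnorm /BKcoef; congr fine.
by case: xgetP => [b -> [pb bf]|/(_ a)[]//]; exact: (wd f).
Qed.

Lemma lpnormE (R : realType) (p : R) (a : nat -> R) : 0 < p ->
  lpnorm p a =
  poweR (\sum_(0 <= n <oo) (`|a n| `^ p)%:E)%E p^-1.
Proof. by move=> p0; rewrite /lpnorm Lnorm_counting. Qed.

(* Main.v *)
(* Since [T_p(s_p) <= T_1(f)] for every [f] in [BK 1] and [rho] grows at least
   linearly, the coefficient sequences [a^p] of [s_p] are bounded in [l_p], so
   along some [p_m --> 1] they converge coordinatewise to a sequence [alpha]
   and their norms converge to some [beta]. A Fatou-type argument gives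
   [|alpha|_1 <= beta], and absolute summability of [phi_n(z)] gives pointwise
   convergence of [s_(p_m)] to [s1 = sum_n alpha_n phi_n] by dominated
   convergence. Convexity makes [L] and [rho] continuous, hence
   [T_1(s1) <= lim T_(p_m)(s_(p_m)) <= inf T_1 <= T_1(s1)]. *)
Require Import Defs.
From mathcomp Require Import all_boot all_order all_algebra.
From mathcomp Require Import all_classical all_reals all_analysis.
From mathcomp Require Import ring lra.
Import Order.TTheory GRing.Theory Num.Theory.
Import numFieldNormedType.Exports.
Local Open Scope classical_set_scope.
Local Open Scope ring_scope.

(** * Convexity and elementary inequalities on the real line *)

Lemma convex_functionP (R : realType) (D : set R) (f : R -> R) :
  convex_function D f <->
  forall t a b, 0 <= t <= 1 -> D a -> D b ->
    f (t * a + (1 - t) * b) <= t * f a + (1 - t) * f b.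
Proof.
split=> [cf t a b /andP[t0 t1] Da Db|cf t a b /set_mem Da /set_mem Db].
  have /(_ a b (mem_set Da) (mem_set Db)) := cf (Itv01 t0 t1).
  by [].
by apply: cf => //; apply/andP.
Qed.

(** Near [c] the function lies below its chords to [c + 1] and [c - 1]; reflecting through [c] turns
    this into a lower bound, so [|f t - f c| <= M * |t - c|] on the unit ball. *)
Lemma convex_continuous (R : realType) (f : R -> R) :
  convex_function [set: R] f -> continuous f.
Proof.
move=> /convex_functionP cf c.
pose M := `|f (c + 1) - f c| + `|f (c - 1) - f c| + 1.
have M0 : 0 < M by rewrite ltr_wpDl// addr_ge0.
have chord e d : 0 <= d <= 1 -> `|e| = 1 -> `|f (c + e * d) - f c| <= d * M.
  move=> d01 e1.
  have /andP[d0 d1] := d01.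
  have e1M u : `|u| = 1 -> f (c + u) - f c <= M.
    move=> /eqP; rewrite eqr_norml ler01 andbT => /orP[]/eqP->; rewrite /M.
      by have := ler_norm (f (c + 1) - f c);
         have := normr_ge0 (f (c - 1) - f c); lra.
    by have := ler_norm (f (c - 1) - f c);
       have := normr_ge0 (f (c + 1) - f c); lra.
  rewrite ler_norml; apply/andP; split; last first.
    have := cf d (c + e) c d01 I I.
    rewrite (_ : d * (c + e) + (1 - d) * c = c + e * d); last by ring.
    by have := ler_wpM2l d0 (e1M _ e1); lra.
  have d1p : 0 < 1 + d by lra.
  (* Lower bound: [c] is the convex combination of [c + e * d] and [c - e] with weights
     [1 / (1 + d)] and [d / (1 + d)]. *)
  have h01 : 0 <= (1 + d)^-1 <= 1 by rewrite invr_ge0 invf_le1//; lra.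
  have := cf _ (c + e * d) (c - e) h01 I I.
  rewrite (_ : (1 + d)^-1 * (c + e * d) + (1 - (1 + d)^-1) * (c - e) = c); last by field; lra.
  rewrite -(ler_pM2l d1p) [leRHS](_ : _ = f (c + e * d) + d * f (c - e)); last by field; lra.
  have : `|- e| = 1 by rewrite normrN.
  move=> /e1M/(ler_wpM2l d0); lra.
apply/cvgrPdist_le => eps eps0; near=> t.
have td : `|t - c| <= Num.min 1 (eps / M).
  by rewrite distrC ltW//; near: t; apply: cvgr_dist_lt => //;
     rewrite lt_min ltr01 divr_gt0.
move: td; rewrite le_min => /andP[td1 tdM].
have -> : t = c + Num.sg (t - c) * `|t - c| by rewrite -numEsg; ring.
rewrite distrC.
have [->|tc] := eqVneq t c; first by rewrite subrr normr0 mulr0 addr0 subrr normr0 ltW.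
apply: le_trans (chord _ _ _ _) _; first by rewrite normr_ge0.
  by rewrite normr_sg subr_eq0 tc.
by rewrite -ler_pdivlMr.
Unshelve. all: by end_near. Qed.

(** Monotonicity carries the triangle inequality through [f]. The even extension lives on the whole
    line, so [convex_continuous] also covers the boundary point [0]. *)
Lemma convex_comp_norm (R : realType) (f : R -> R) :
  convex_function (`[0, +oo[ : set R) f ->
  {in `[0, +oo[ &, {homo f : t u / t < u}} ->
  convex_function [set: R] (f \o Num.norm).
Proof.
move=> /convex_functionP cf mf; apply/convex_functionP => t a b t01 _ _ /=.
have /andP[t0 t1] := t01.
have nneg (z : R) : 0 <= z -> z \in `[0, +oo[ by rewrite in_itv/= andbT.
apply: (@le_trans _ _ (f (t * `|a| + (1 - t) * `|b|))); last first.
  by apply: cf => //=; rewrite in_itv/= andbT.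
have : `|t * a + (1 - t) * b| <= t * `|a| + (1 - t) * `|b|.
  by rewrite (le_trans (ler_normD _ _))// !normrM (ger0_norm t0) (@ger0_norm _ (1 - t)) ?subr_ge0.
rewrite le_eqVlt => /predU1P[->//|h].
by apply/ltW/mf => //; apply: nneg => //; rewrite addr_ge0// mulr_ge0// subr_ge0.
Qed.

(** For [1 <= t] the point [1] lies under the chord from [0] to [t]; the extra summand [f 1 - f 0]
    absorbs the case [t < 1]. This makes the penalty coercive. *)
Lemma convex_increasing_ge_linear (R : realType) (f : R -> R) t :
  convex_function (`[0, +oo[ : set R) f ->
  {in `[0, +oo[ &, {homo f : t u / t < u}} ->
  0 <= t -> t * (f 1 - f 0) <= (f t - f 0) + (f 1 - f 0).
Proof.
move=> /convex_functionP cf mf t0.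
have nneg (z : R) : 0 <= z -> z \in `[0, +oo[ by rewrite in_itv/= andbT.
have f01 : 0 < f 1 - f 0 by rewrite subr_gt0 mf// nneg.
have [t1|t1] := leP 1 t.
  have h01 : 0 <= t^-1 <= 1 by rewrite invr_ge0 invf_le1//; lra.
  have := cf t^-1 t 0 h01 (nneg _ t0) (nneg _ (lexx _)).
  rewrite mulr0 addr0 mulVf ?gt_eqF//; last lra.
  move=> /(ler_wpM2l t0).
  rewrite [leRHS](_ : _ = f t + (t - 1) * f 0); last by field; lra.
  lra.
have f0t : f 0 <= f t.
  by move: t0; rewrite le_eqVlt => /predU1P[<-//|t0]; rewrite ltW// mf// nneg// ltW.
have := ler_wpM2r (ltW f01) (ltW t1); lra.
Qed.

(** Write [u ^ p = u * exp ((p - 1) * ln u)] and use [exp v >= 1 + v] and [ln u >= 1 - 1 / u]. The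
    loss [p - 1] does not depend on [u] and vanishes as [p] tends to [1]. *)
Lemma powR_ge_sub (R : realType) (u p : R) :
  0 <= u -> 1 <= p -> u - (p - 1) <= u `^ p.
Proof.
rewrite le_eqVlt => /predU1P[<-|u0] p1.
  by rewrite (le_trans _ (powR_ge0 _ _))//; lra.
rewrite /powR gt_eqF// (_ : p * ln u = ln u + (p - 1) * ln u); last by ring.
rewrite expRD lnK ?posrE//.
have lnu : 1 - u^-1 <= ln u.
  have ui0 : 0 < u^-1 by rewrite invr_gt0.
  have /le_ln1Dx : -1 < u^-1 - 1 by lra.
  rewrite (_ : 1 + (u^-1 - 1) = u^-1); last by ring.
  by rewrite lnV ?posrE//; lra.
have expge : 1 + (p - 1) * (1 - u^-1) <= expR ((p - 1) * ln u).
  apply: le_trans (expR_ge1Dx _); rewrite lerD2l ler_wpM2l//; lra.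
apply: le_trans (ler_wpM2l (ltW u0) expge).
rewrite (_ : u * _ = u + (p - 1) * (u - 1)); last by field; lra.
have : 0 <= (p - 1) * u by rewrite mulr_ge0//; lra.
lra.
Qed.

(** * Norms in [l_p] and their comparison for different exponents *)

Section lp_facts.
Variable R : realType.
Implicit Types (a : R^nat) (p : R).

Lemma sum_powR_le_lpnorm p a M : 0 < p -> lp p a ->
  \sum_(0 <= n < M) `|a n| `^ p <= fine (lpnorm p a) `^ p.
Proof.
move=> p0 pa.
have fn : lpnorm p a \is a fin_num by rewrite ge0_fin_numE// lpnormE// poweR_ge0.
rewrite -lee_fin -poweR_EFin fineK// lpnormE// -poweRrM mulVf ?gt_eqF// poweRe1; last first.
  by apply: nneseries_ge0 => n _ _; rewrite lee_fin powR_ge0.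
rewrite -sumEFin; apply: nneseries_lim_ge => n _ _.
by rewrite lee_fin powR_ge0.
Qed.

(** Membership has to accompany the bound, since [fine] sends an infinite norm to [0]. *)
Lemma lpnorm_le p a B : 0 < p -> 0 <= B ->
  (forall M, \sum_(0 <= n < M) `|a n| `^ p <= B `^ p) ->
  lp p a /\ fine (lpnorm p a) <= B.
Proof.
move=> p0 B0 aB.
have h : (lpnorm p a <= B%:E)%E.
  have -> : B%:E = ((B `^ p)%:E `^ p^-1)%E.
    by rewrite poweR_EFin -powRrM mulfV ?gt_eqF// powRr1.
  rewrite lpnormE//; apply: gt0_ler_poweR.
  - by rewrite invr_ge0 ltW.
  - rewrite in_itv/= leey andbT; apply: nneseries_ge0 => n _ _.
    by rewrite lee_fin powR_ge0.
  - by rewrite in_itv/= leey andbT lee_fin powR_ge0.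
  apply: lime_le.
    by apply: is_cvg_nneseries => n _ _; rewrite lee_fin powR_ge0.
  by near=> M; rewrite sumEFin lee_fin.
split; first by rewrite /lp/= (le_lt_trans h)// ltry.
rewrite -lee_fin fineK// ge0_fin_numE ?(le_lt_trans h) ?ltry//.
by rewrite lpnormE// poweR_ge0.
Unshelve. all: by end_near. Qed.

Lemma lpnorm_ge0 p a : 0 < p -> 0 <= fine (lpnorm p a).
Proof. by move=> p0; rewrite fine_ge0// lpnormE// poweR_ge0. Qed.

Lemma coef_le_lpnorm p a n : 0 < p -> lp p a -> `|a n| <= fine (lpnorm p a).
Proof.
move=> p0 pa; rewrite leNgt; apply/negP => lt.
have := @sum_powR_le_lpnorm p a n.+1 p0 pa; apply/negP; rewrite -ltNge.
rewrite big_nat_recr//=; apply: ltr_wpDl.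
  by apply: sumr_ge0 => i _; exact: powR_ge0.
by apply: gt0_ltr_powR => //; rewrite nnegrE ?lpnorm_ge0.
Qed.

(* After normalising [lpnorm p a] to [1], each summand satisfies [u <= u ^ p + (p - 1)]. *)
Lemma sum_le_lpnorm p a M : 1 <= p -> lp p a ->
  \sum_(0 <= n < M) `|a n| <= fine (lpnorm p a) * (1 + M%:R * (p - 1)).
Proof.
move=> p1 pa; have p0 : 0 < p by lra.
set B := fine _.
have [B0|B0] := eqVneq B 0.
  rewrite B0 mul0r big1// => n _; apply/eqP; rewrite eq_le normr_ge0 andbT.
  by rewrite -B0 coef_le_lpnorm.
have {}B0 : 0 < B by rewrite lt_neqAle eq_sym B0 lpnorm_ge0.
have h : \sum_(0 <= n < M) (`|a n| / B) `^ p <= 1.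
  rewrite -(ler_pM2l (powR_gt0 p B0)) mulr1 mulr_sumr.
  apply: le_trans (@sum_powR_le_lpnorm p a M p0 pa).
  by apply: ler_sum => n _; rewrite -powRM ?divr_ge0 ?(ltW B0)// mulrC divfK ?gt_eqF.
rewrite mulrC -ler_pdivrMr// mulr_suml.
rewrite -lerBlDr; apply: le_trans h.
rewrite (_ : M%:R * (p - 1) = \sum_(0 <= n < M) (p - 1)); last first.
  by rewrite sumr_const_nat subn0 mulr_natl.
rewrite -sumrB; apply: ler_sum => n _.
by apply: powR_ge_sub => //; rewrite divr_ge0// ltW.
Qed.

(** Split [|a n| ^ p] as [|a n| * |a n| ^ (p - 1)]; every [|a n|] is at most [A], so the second
    factor is at most [A ^ (p - 1)]. *)
Lemma lp_mono p a : 1 <= p -> lp 1 a ->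
  lp p a /\ fine (lpnorm p a) <= fine (lpnorm 1 a).
Proof.
move=> p1 la; have p0 : 0 < p by lra.
set A := fine (lpnorm 1 a); have A0 : 0 <= A by apply: lpnorm_ge0.
apply: lpnorm_le => // M; rewrite -/A.
rewrite -(@mulr_powRB1 _ A)//.
apply: (@le_trans _ _ (\sum_(0 <= n < M) `|a n| * A `^ (p - 1))); last first.
  rewrite -mulr_suml ler_wpM2r ?powR_ge0//.
  have := @sum_le_lpnorm 1 a M (lexx _) la.
  by rewrite subrr mulr0 addr0 mulr1.
apply: ler_sum => n _; rewrite -(@mulr_powRB1 _ `|a n|)// ler_wpM2l//.
apply: ge0_ler_powR => //; rewrite ?nnegrE//; first lra.
exact: coef_le_lpnorm.
Qed.

End lp_facts.

(** * Dominated convergence for series *)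

Section dominated_series.
Variable R : realType.
Implicit Types u v : R^nat.

Lemma cvg_series_dominated u v : (forall n, `|u n| <= v n) ->
  cvgn (series v) -> cvgn (series u).
Proof.
move=> uv cv; apply: normed_cvg; apply: series_le_cvg cv => //= n.
exact: le_trans (uv n).
Qed.

Lemma series_tail_dominated u v M : (forall n, `|u n| <= v n) ->
  cvgn (series v) ->
  `|limn (series u) - series u M| <= limn (series v) - series v M.
Proof.
move=> uv cv; have cu := cvg_series_dominated _ _ uv cv.
have lu : (fun k => `|series u k - series u M|) @ \oo -->
    `|limn (series u) - series u M|.
  by apply: cvg_norm; apply: cvgB => //; apply: cvg_cst.
have lv : (fun k => series v k - series v M) @ \oo -->
    limn (series v) - series v M.
  by apply: cvgB => //; apply: cvg_cst.
apply: (ler_cvg_to lu lv); near=> k.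
have Mk : (M <= k)%N by near: k; exact: nbhs_infty_ge.
rewrite !sub_series_geq//; apply: le_trans (ler_norm_sum _ _ _) _.
by apply: ler_sum.
Unshelve. all: by end_near. Qed.

(** Cut at an index [M] where the tail of [v] is below [e / 3]: the finite heads converge termwise,
    and both tails are dominated uniformly in [m]. *)
Lemma series_dominated_convergence (g : nat -> R^nat) u v :
  (forall m n, `|g m n| <= v n) -> cvgn (series v) ->
  (forall n, g m n @[m --> \oo] --> u n) ->
  limn (series (g m)) @[m --> \oo] --> limn (series u).
Proof.
move=> gv cv gu.
have uv n : `|u n| <= v n.
  apply: (ler_cvg_to (cvg_norm (gu n)) (cvg_cst (v n))).
  by near=> m.
apply/cvgrPdist_lt => e e0.
have e3 : 0 < e / 3 by lra.
have [M _ /(_ M (leqnn _))/= vM] := cvgr_dist_lt _ _ cv (e / 3) e3.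
have sgu : series (g m) M @[m --> \oo] --> series u M.
  rewrite /series/=; apply: cvg_big => //.
  exact: add_continuous.
near=> m.
have : `|series u M - series (g m) M| < e / 3.
  by near: m; exact: cvgr_dist_lt.
have := series_tail_dominated _ _ M uv cv.
have := series_tail_dominated _ _ M (gv m) cv.
move: vM; rewrite !(ltr_norml, ler_norml); lra.
Unshelve. all: by end_near. Qed.

End dominated_series.

(** * Extraction of a coordinatewise limit *)

(** By Tychonoff the sequence has a cluster point [w] in a product of segments; stage [m] picks a
    late index that is close to [w] on the first [m] coordinates. [k] need not be increasing:
    [m <= k m] already makes it tend to infinity. *)
Lemma bounded_coordinatewise_cvg (R : realType) (u : nat -> R^nat) (C : R) :
  (forall k n, `|u k n| <= C) ->
  exists (w : R^nat) (k : nat -> nat),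
    (forall m, (m <= k m)%N) /\ forall n, u (k m) n @[m --> \oo] --> w n.
Proof.
move=> uC.
have cpt := @tychonoff nat (fun=> R) (fun=> `[- C, C]%classic)
  (fun=> @segment_compact R _ _).
have [|w [_ wcl]] := cpt (u @ \oo) _.
  by exists 0%N => // k _ n /=; rewrite in_itv/= -ler_norml.
have step m : exists k, (m <= k)%N /\ forall n, (n < m)%N -> `|w n - u k n| < m.+1%:R^-1.
  have Bw : nbhs w [set f : forall n : nat, R | forall n, (n < m)%N -> `|w n - f n| < m.+1%:R^-1].
    suff : \forall f \near w,
        forall i : 'I_m, `|w i - (f : nat -> R) i| < m.+1%:R^-1.
      by apply: filterS => f fw n nm; exact: (fw (Ordinal nm)).
    apply: (@filter_forall _ 'I_m
      (fun i => [set f | `|w i - (f : nat -> R) i| < m.+1%:R^-1]) (nbhs w)) => i.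
    have : nbhs (w i) [set z | `|w i - z| < m.+1%:R^-1].
      by apply: (@nbhsx_ballx R R); rewrite invr_gt0.
    exact: (@proj_continuous nat (fun=> R) i w).
  have tail : (u @ \oo) (u @` [set k | (m <= k)%N]).
    by exists m => // k mk; exists k.
  by have [_ [[k mk <-] fw]] := wcl _ _ tail Bw; exists k.
have [k kP] := choice step.
exists w, k; split=> [m|n]; first by case: (kP m).
apply/cvgrPdist_lt => e e0; near=> m.
have [_ /(_ n)] := kP m.
move=> /(_ _)/lt_trans; apply.
  by near: m; exact: nbhs_infty_gt.
by near: m; exact: near_infty_natSinv_lt (PosNum e0).
Unshelve. all: by end_near. Qed.

(** * Convergence of the minimizers as the exponent tends to [1] *)

Theorem theorem5p9 (R : realType) (Omega Omega' : ptopologicalType)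
    (mu : {measure set (borel Omega) -> \bar R})
    (mu' : {measure set (borel Omega') -> \bar R})
    (K : Omega * Omega' -> R)
    (phi : nat -> Omega -> R) (phi' : nat -> Omega' -> R)
    (N : nat) (x : 'I_N -> Omega) (y : 'I_N -> R)
    (rho : R -> R) (L : Omega -> R -> R -> R)
    (s : R -> Omega -> R) :
  hausdorff_space Omega -> locally_compact [set: Omega] ->
  hausdorff_space Omega' -> locally_compact [set: Omega'] ->
  regular_borel mu -> regular_borel mu' ->
  generalized_mercer K phi phi' ->
  (forall z, cvgn (series (fun n => `|phi n z|))) ->
  (forall z, cvgn (series (fun n => `|phi' n z|))) ->
  lin_indep (fun (z : Omega) (w : Omega') => K (z, w)) ->
  (forall p, 1 <= p <= 2 -> BKnorm_well_defined phi p) ->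
  (0 < N)%N -> injective x ->
  (forall t, 0 <= t -> 0 <= rho t) ->
  convex_function (`[0, +oo[ : set R) rho ->
  {in `[0, +oo[ &, {homo rho : t u / t < u}} ->
  (forall z v t, 0 <= L z v t) ->
  (forall z v, convex_function [set: R] (L z v)) ->
  (forall p, 1 < p <= 2 ->
     is_minimizer (BK phi p) (svm phi L rho x y p) (s p)) ->
  exists s1 : Omega -> R,
    is_minimizer (BK phi 1) (svm phi L rho x y 1) s1 /\
    exists p : nat -> R,
      [/\ forall m, 1 < p m <= 2,
          p m @[m --> \oo] --> (1 : R),
          forall z, s (p m) z @[m --> \oo] --> s1 z &
          svm phi L rho x y (p m) (s (p m)) @[m --> \oo]
            --> svm phi L rho x y 1 s1].

Proof.
move=> _ _ _ _ _ _ _ phi_sum _ _ wd _ _ rho_ge0 rho_convex rho_incr L_ge0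
  L_convex s_min.
pose loss f := N%:R^-1 * \sum_(k < N) L (x k) (y k) (f (x k)).
have svmE p a f : 1 <= p <= 2 -> lp p a -> expands phi a f ->
    svm phi L rho x y p f = loss f + rho (fine (lpnorm p a)).
  by move=> /wd wdp pa af; rewrite /svm (BKnormE wdp pa af).
have loss_ge0 f : 0 <= loss f.
  by rewrite mulr_ge0 ?invr_ge0// sumr_ge0.
have rho_le t u : 0 <= t -> t <= u -> rho t <= rho u.
  move=> t0; rewrite le_eqVlt => /predU1P[->//|tu].
  by rewrite ltW// rho_incr// in_itv/= andbT// (le_trans t0)// ltW.
(* [f] competes with [s p]: its [l_1] coefficients lie in [l_p] with no larger norm, and [rho] is
   monotone. *)
have svm_le p f : 1 < p <= 2 -> BK phi 1 f ->
    svm phi L rho x y p (s p) <= svm phi L rho x y 1 f.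
  move=> p12 [a la af]; have /andP[p1 p2] := p12.
  have [pa le_a] := @lp_mono _ p a (ltW p1) la.
  have [_ /(_ f)] := s_min p p12; move/(_ _)/le_trans; apply; first by exists a.
  rewrite (svmE p a)// ?(ltW p1)// (svmE 1 a)// ?lexx ?ler1n//.
  by rewrite lerD2l rho_le// lpnorm_ge0//; lra.
pose q k : R := 1 + k.+1%:R^-1.
have q12 k : 1 < q k <= 2.
  rewrite /q; have : 0 < k.+1%:R^-1 :> R by rewrite invr_gt0.
  have : k.+1%:R^-1 <= 1 :> R by rewrite invf_le1// ler1n.
  by move: k.+1%:R^-1 => t t1 t0; apply/andP; split; lra.
have q_gt0 k : 0 < q k by rewrite addr_gt0// invr_gt0.
(* Any [l_(q k)] expansion of [s (q k)] will do: by [wd] its norm is the one that enters the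
   penalty. *)
have [a aP] : {a : nat -> R^nat &
    forall k, lp (q k) (a k) /\ expands phi (a k) (s (q k))}.
  apply: (@choice _ _ (fun k a => lp (q k) a /\ expands phi a (s (q k)))) => k.
  by have [[a pa af] _] := s_min _ (q12 k); exists a.
pose b k := fine (lpnorm (q k) (a k)).
have b_ge0 k : 0 <= b k by exact: lpnorm_ge0.
have svm_sq k : svm phi L rho x y (q k) (s (q k)) = loss (s (q k)) + rho (b k).
  have [? ?] := aP k; apply: svmE => //.
  by have /andP[/ltW -> ->] := q12 k.
have BK0 : BK phi 1 (fun=> 0).
  exists (fun=> 0).
    have [] // := @lpnorm_le R 1 (fun=> 0) 0 ltr01 (lexx _).
    by move=> M; rewrite big1 ?powR_ge0// => n _; rewrite normr0 powR0.
  move=> z; rewrite /series/=.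
  under eq_fun do under eq_bigr do rewrite mul0r.
  under eq_fun do rewrite big1//.
  exact: cvg_cst.
pose T0 := svm phi L rho x y 1 (fun=> 0).
pose D := rho 1 - rho 0.
have D0 : 0 < D by rewrite subr_gt0 rho_incr// in_itv/= ?lexx ?ler01.
(* [C] solves the linear growth bound for [b k], using [rho (b k) <= T0], which holds because the
   zero function competes and the loss is nonnegative. *)
pose C := ((T0 - rho 0) + D) / D.
have bC k : b k <= C.
  have := convex_increasing_ge_linear _ _ _ rho_convex rho_incr (b_ge0 k).
  rewrite ler_pdivlMr// => /le_trans; apply.
  have := svm_le _ _ (q12 k) BK0; rewrite svm_sq -/T0 -/D.
  by have := loss_ge0 (s (q k)); lra.
have aC k n : `|a k n| <= C.
  by rewrite (le_trans _ (bC k))// coef_le_lpnorm//; have [] := aP k.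
(* Coordinate [0] carries the norms, so that one extraction handles both. *)
pose u k n := if n is n'.+1 then a k n' else b k.
have [|w [j [jm uw]]] := @bounded_coordinatewise_cvg R u C.
  by move=> k [|n]//=; rewrite ger0_norm.
pose alpha n := w n.+1.
have a_alpha n : a (j m) n @[m --> \oo] --> alpha n := uw n.+1.
have b_beta : b (j m) @[m --> \oo] --> w 0%N := uw 0%N.
have qj1 : q (j m) @[m --> \oo] --> (1 : R).
  apply: (@squeeze_cvgr _ _ _ _ (fun=> 1) (fun m => 1 + m.+1%:R^-1)).
  - apply: nearW => m; have /andP[/ltW -> _] := q12 (j m) => /=.
    by rewrite lerD2l lef_pV2 ?posrE// ler_nat ltnS.
  - exact: cvg_cst.
  - rewrite -[X in _ --> X]addr0; apply: cvgD; first exact: cvg_cst.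
    exact: cvg_harmonic.
have beta_ge0 : 0 <= w 0%N.
  by apply: (ler_cvg_to (cvg_cst 0) b_beta); apply: nearW.
(* For fixed [M] the factor [1 + M * (q - 1)] of [sum_le_lpnorm] tends to [1], which bounds each
   partial sum of [|alpha n|] by the limit of the norms. *)
have [l1alpha alpha_beta] : lp 1 alpha /\ fine (lpnorm 1 alpha) <= w 0%N.
  apply: lpnorm_le => // M; rewrite powRr1//.
  under eq_bigr do rewrite powRr1//.
  have lhs : \sum_(0 <= n < M) `|a (j m) n| @[m --> \oo] -->
      \sum_(0 <= n < M) `|alpha n|.
    apply: cvg_big => //; first exact: add_continuous.
    by move=> n _; apply: cvg_norm.
  have rhs : b (j m) * (1 + M%:R * (q (j m) - 1)) @[m --> \oo] --> w 0%N.
    rewrite -[X in _ --> X]mulr1; apply: cvgM => //.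
    rewrite -[X in _ --> X]addr0; apply: cvgD; first exact: cvg_cst.
    rewrite -(mulr0 M%:R) -(subrr 1); apply: cvgM; first exact: cvg_cst.
    by apply: cvgB => //; exact: cvg_cst.
  apply: (ler_cvg_to lhs rhs); apply: nearW => m.
  have [? _] := aP (j m); apply: sum_le_lpnorm => //.
  by have /andP[/ltW] := q12 (j m).
have dom k z n : `|a k n * phi n z| <= C * `|phi n z|.
  by rewrite normrM ler_wpM2r.
have dom_cvg z : cvgn (series (fun n => C * `|phi n z|)).
  exact: (@is_cvg_seriesZ _ _ C (phi_sum z)).
have alphaC n : `|alpha n| <= C.
  by apply: (ler_cvg_to (cvg_norm (a_alpha n)) (cvg_cst C)); apply: nearW.
pose s1 z := limn (series (fun n => alpha n * phi n z)).
have alpha_s1 : expands phi alpha s1.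
  move=> z; apply: cvg_series_dominated (dom_cvg z) => n.
  by rewrite normrM ler_wpM2r.
have s_s1 z : s (q (j m)) z @[m --> \oo] --> s1 z.
  have -> : (fun m => s (q (j m)) z) =
      fun m => limn (series (fun n => a (j m) n * phi n z)).
    by apply/funext => m; have [_ /(_ z)/cvg_lim ->] := aP (j m).
  apply: (@series_dominated_convergence _ _ _ _ (fun m n => dom (j m) z n)) => // n.
  by apply: cvgM => //; exact: cvg_cst.
have loss_cvg : loss (s (q (j m))) @[m --> \oo] --> loss s1.
  apply: cvgM; first exact: cvg_cst.
  apply: cvg_big => //; first exact: add_continuous.
  move=> k _; have /convex_continuous L_cont := L_convex (x k) (y k).
  exact: continuous_cvg (L_cont _) (s_s1 (x k)).
have rho_cvg : rho (b (j m)) @[m --> \oo] --> rho (w 0%N).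
  (* The norms and their limit are nonnegative, so [rho] may be replaced there by its even
     extension. *)
  have /convex_continuous rho_cont := convex_comp_norm _ _ rho_convex rho_incr.
  rewrite -(ger0_norm beta_ge0); under eq_fun do rewrite -[b _]ger0_norm//.
  exact: continuous_cvg (rho_cont _) b_beta.
have svm_cvg : svm phi L rho x y (q (j m)) (s (q (j m))) @[m --> \oo] -->
    loss s1 + rho (w 0%N).
  by under eq_fun do rewrite svm_sq; apply: cvgD.
have lim_le f : BK phi 1 f -> loss s1 + rho (w 0%N) <= svm phi L rho x y 1 f.
  move=> f1; apply: (ler_cvg_to svm_cvg (cvg_cst _)).
  by apply: nearW => m; exact: svm_le.
have BKs1 : BK phi 1 s1 by exists alpha.
(* No norm is lost in the penalty: [lim_le] at [s1] itself gives one inequality, [alpha_beta] with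
   monotone [rho] the other. *)
have svm_s1 : svm phi L rho x y 1 s1 = loss s1 + rho (w 0%N).
  apply/eqP; rewrite eq_le lim_le// andbT (svmE 1 alpha)// ?lexx ?ler1n//.
  by rewrite lerD2l rho_le// lpnorm_ge0.
exists s1; split; first by split=> // f; rewrite svm_s1; exact: lim_le.
by exists (q \o j); split=> [m|||] //=; rewrite ?svm_s1.
Qed.
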